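(* Let $N, M \geq 1$ be integers, let $\Delta t > 0$, and let $c, \beta, \gamma \geq 0$ and $J$, $\mathfrak{m}^2$ be real numbers. Let $(u_n^k)$, $0 \leq n \leq N+1$, $0 \leq k \leq M+1$, be real numbers satisfying the following finite-difference scheme: for all $1 \leq n \leq N$ and $1 \leq k \leq M$, $$\frac{\delta_t^2 u_n^k}{(\Delta t)^2} - \left( \frac{c^2}{2} \bar{\delta} + \frac{\beta}{2 \Delta t} \delta_t \right) \delta_x^2 u_n^k + \frac{\gamma}{2 \Delta t} \delta_t u_n^k + \frac{\mathfrak{m}^2}{2} \bar{\delta} u_n^k + \frac{V(u_n^{k+1}) - V(u_n^{k-1})}{u_n^{k+1} - u_n^{k-1}} = J,$$ subject to $$u_n^0 = 0, \quad u_n^1 = 0 \quad (1 \leq n \leq N),$$ $$c^2 \bar{\delta}(u_0^k - u_1^k) + \frac{\beta\, \delta_t (u_0^k - u_1^k)}{\Delta t} = 2 \phi_k \quad (1 \leq k \leq M),$$ $$u_{N+1}^k - u_N^k = 0 \quad (0 \leq k \leq M+1).$$ For $0 \leq k \leq M$ define $$\begin{aligned} H_n^k = {}& \frac{1}{2} \left( \frac{u_n^{k+1} - u_n^k}{\Delta t} \right)^2 + \frac{c^2}{8} \left[ (u_{n+1}^{k+1} - u_n^{k+1})^2 + (u_{n-1}^{k+1} - u_n^{k+1})^2 + (u_{n+1}^k - u_n^k)^2 + (u_{n-1}^k - u_n^k)^2 \right] \\ & + \frac{\mathfrak{m}^2}{2} \cdot \frac{(u_n^{k+1})^2 + (u_n^k)^2}{2}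 + \frac{V(u_n^{k+1}) + V(u_n^k)}{2} - J\, \frac{u_n^{k+1} + u_n^k}{2} \qquad (1 \leq n \leq N), \end{aligned}$$ $$E_k = \sum_{n=1}^N H_n^k + \frac{c^2}{4} \left[ \frac{(u_1^{k+1} - u_0^{k+1})^2 + (u_1^k - u_0^k)^2}{2} \right].$$ Then, for every $1 \leq k \leq M$, $$\begin{aligned} \frac{E_k - E_{k-1}}{\Delta t} = {}& - \beta \left\{ \sum_{n=1}^N \left( \frac{\delta_t u_n^k - \delta_t u_{n-1}^k}{2 \Delta t} \right)^2 + \left( \frac{\delta_t u_1^k - \delta_t u_0^k}{2 \Delta t} \right) \frac{\delta_t u_0^k}{2 \Delta t} \right\} \\ & - \gamma \sum_{n=1}^N \left( \frac{\delta_t u_n^k}{2 \Delta t} \right)^2 + c^2 \left( \frac{\bar{\delta} u_0^k - \bar{\delta} u_1^k}{2} \right) \frac{\delta_t u_0^k}{2 \Delta t}. \end{aligned}$$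
   Context: The potential is $V(u) = 1 - \cos u$. The difference operators are $$\delta_t u_n^k = u_n^{k+1} - u_n^{k-1}, \quad \delta_t^2 u_n^k = u_n^{k+1} - 2 u_n^k + u_n^{k-1}, \quad \delta_x^2 u_n^k = u_{n+1}^k - 2 u_n^k + u_{n-1}^k, \quad \bar{\delta} u_n^k = u_n^{k+1} + u_n^{k-1},$$ and operators in the time index and in the space index are composed, so for example $\bar{\delta}\delta_x^2 u_n^k = \delta_x^2 u_n^{k+1} + \delta_x^2 u_n^{k-1}$ and $\delta_t \delta_x^2 u_n^k = \delta_x^2 u_n^{k+1} - \delta_x^2 u_n^{k-1}$. Note that $\delta_t$ does not include division by the time step. The numbers $\phi_k = \phi(k \Delta t)$ are the values of the driving function $\phi(t) = A \sin(\Omega t)$, with $A$, $\Omega$ real constants. The constant $\mathfrak{m}$ is a real or pure-imaginary number, so $\mathfrak{m}^2$ is real. The quotient $\frac{V(u_n^{k+1}) - V(u_n^{k-1})}{u_n^{k+1} - u_n^{k-1}}$ is understood as $V'(u_n^{k-1})$ when $u_n^{k+1} = u_n^{k-1}$. *)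

(* Defs.v *)
From mathcomp Require Import all_boot all_order all_algebra.
From mathcomp Require Import all_classical all_reals all_analysis.

Set Implicit Arguments.
Unset Strict Implicit.
Unset Printing Implicit Defensive.

Import Order.TTheory GRing.Theory Num.Theory.
Import numFieldNormedType.Exports.

Local Open Scope ring_scope.

Definition V (R : realType) (x : R) : R := 1 - cos x.

Definition phi (R : realType) (A Omega t : R) : R := A * sin (Omega * t).

(* Time operators act on a sequence indexed by the time step.  The predecessor
   is only meaningful for k >= 1; delta_t carries no division by the time
   step. *)
Definition delta_t (R : realType) (v : nat -> R) (k : nat) : R :=
  v k.+1 - v k.-1.

Definition delta_t2 (R : realType) (v : nat -> R) (k : nat) : R :=
  v k.+1 - 2 * v k + v k.-1.

Definition delta_bar (R : realType) (v : nat -> R) (k : nat) : R :=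
  v k.+1 + v k.-1.

(* A grid function is written u n k, with the space index n first.  The result
   at node n >= 1 is again a time sequence, so delta_bar (delta_x2 u n) k is
   the composed operator. *)
Definition delta_x2 (R : realType) (u : nat -> nat -> R) (n : nat) : nat -> R :=
  fun k => u n.+1 k - 2 * u n k + u n.-1 k.

(* Difference quotient of V from b to a, extended by V'(b) when a = b. *)
Definition V_quot (R : realType) (a b : R) : R :=
  if a == b then derive1 (@V R) b else (V a - V b) / (a - b).

(* Here m2 is the squared mass, an arbitrary real of either sign. *)
Definition H (R : realType) (dt c J m2 : R) (u : nat -> nat -> R)
    (n k : nat) : R :=
  1 / 2 * ((u n k.+1 - u n k) / dt) ^+ 2
  + c ^+ 2 / 8 * ((u n.+1 k.+1 - u n k.+1) ^+ 2
                  + (u n.-1 k.+1 - u n k.+1) ^+ 2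
                  + (u n.+1 k - u n k) ^+ 2
                  + (u n.-1 k - u n k) ^+ 2)
  + m2 / 2 * ((u n k.+1 ^+ 2 + u n k ^+ 2) / 2)
  + (V (u n k.+1) + V (u n k)) / 2
  - J * ((u n k.+1 + u n k) / 2).

Definition E (R : realType) (N : nat) (dt c J m2 : R) (u : nat -> nat -> R)
    (k : nat) : R :=
  \sum_(1 <= n < N.+1) H dt c J m2 u n k
  + c ^+ 2 / 4 * (((u 1%N k.+1 - u 0%N k.+1) ^+ 2
                   + (u 1%N k - u 0%N k) ^+ 2) / 2).

(* Main.v *)
(* Multiplying the scheme by [delta_t u_n^k / 2] turns each local energy increment
   into dissipation plus the increment in [n] of a flux (a discrete summation by
   parts). Summing over [n], the flux at the right end vanishes by the Neumann
   condition, and the flux at the left end combines with the boundary term of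
   the energy into the boundary work. *)

Require Import Defs.
From mathcomp Require Import all_boot all_order all_algebra.
From mathcomp Require Import all_classical all_reals all_analysis.
From mathcomp Require Import ring.

Import Order.TTheory GRing.Theory Num.Theory.
Import numFieldNormedType.Exports.

Local Open Scope ring_scope.

(** Discrete chain rule, through which alone the potential enters the energy balance; for [a = b]
    both sides vanish. *)
Lemma V_quotM (R : realType) (a b : R) : V_quot a b * (a - b) = V a - V b.
Proof.
rewrite /V_quot; case: eqVneq => [->|neq_ab]; first by rewrite !subrr mulr0.
by rewrite divfK // subr_eq0.
Qed.

(** Flux through the link from [n.-1] to [n]. The first two terms are the boundary terms of the
    summation by parts. The third arises because [H] gives half of each link's elastic energy to
    either end node. *)
Definition energy_flux {R : realType} (dt c beta : R) (u : nat -> nat -> R)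
    (k n : nat) : R :=
  let jump_t := delta_t (u n) k - delta_t (u n.-1) k in
  let jump_bar := delta_bar (u n) k - delta_bar (u n.-1) k in
  c ^+ 2 / 4 * (delta_t (u n.-1) k * jump_bar)
  + beta / (4 * dt) * (delta_t (u n.-1) k * jump_t)
  + c ^+ 2 / 8 * (jump_t * jump_bar).

Lemma local_energy_balance (R : realType) (dt c beta gamma J m2 : R)
    (u : nat -> nat -> R) (n k : nat) :
  dt != 0 -> (0 < n)%N -> (0 < k)%N ->
  delta_t2 (u n) k / dt ^+ 2
    - (c ^+ 2 / 2 * delta_bar (delta_x2 u n) k
       + beta / (2 * dt) * delta_t (delta_x2 u n) k)
    + gamma / (2 * dt) * delta_t (u n) k
    + m2 / 2 * delta_bar (u n) k
    + V_quot (u n k.+1) (u n k.-1) = J ->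
  H dt c J m2 u n k - H dt c J m2 u n k.-1
  = energy_flux dt c beta u k n.+1 - energy_flux dt c beta u k n
    - dt * (beta * ((delta_t (u n) k - delta_t (u n.-1) k) / (2 * dt)) ^+ 2
            + gamma * (delta_t (u n) k / (2 * dt)) ^+ 2).
Proof.
(* Eliminating [J] amounts to multiplying the scheme by [delta_t (u n) k / 2], since [J] enters the
   increment of [H] with exactly this factor, up to sign. *)
case: n k => [//|n] [//|k] dt0 _ _ <-; have := V_quotM _ (u n.+1 k.+2) (u n.+1 k).
rewrite /H /energy_flux /delta_t2 /delta_bar /delta_t /delta_x2 /=.
(* With the quotient as a free variable [q] and the later potential value eliminated, a rational
   identity remains. *)
move: (V_quot _ _) => q /eqP; rewrite eq_sym subr_eq => /eqP ->.
by field.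
Qed.

Theorem proposition3 (R : realType) (N M : nat) (dt c beta gamma J m2 A Omega : R)
  (u : nat -> nat -> R)
  (hN : (1 <= N)%N) (hM : (1 <= M)%N) (hdt : 0 < dt)
  (hc : 0 <= c) (hbeta : 0 <= beta) (hgamma : 0 <= gamma)
  (scheme : forall n k : nat, (1 <= n <= N)%N -> (1 <= k <= M)%N ->
     delta_t2 (u n) k / dt ^+ 2
     - (c ^+ 2 / 2 * delta_bar (delta_x2 u n) k
        + beta / (2 * dt) * delta_t (delta_x2 u n) k)
     + gamma / (2 * dt) * delta_t (u n) k
     + m2 / 2 * delta_bar (u n) k
     + V_quot (u n k.+1) (u n k.-1)
     = J)
  (init : forall n : nat, (1 <= n <= N)%N -> u n 0%N = 0 /\ u n 1%N = 0)
  (left_bc : forall k : nat, (1 <= k <= M)%N ->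
     c ^+ 2 * delta_bar (fun j => u 0%N j - u 1%N j) k
     + beta * delta_t (fun j => u 0%N j - u 1%N j) k / dt
     = 2 * phi A Omega (k%:R * dt))
  (right_bc : forall k : nat, (0 <= k <= M.+1)%N -> u N.+1 k - u N k = 0) :
  forall k : nat, (1 <= k <= M)%N ->
    (E N dt c J m2 u k - E N dt c J m2 u k.-1) / dt
    = - beta * (\sum_(1 <= n < N.+1)
                   ((delta_t (u n) k - delta_t (u n.-1) k) / (2 * dt)) ^+ 2
                + (delta_t (u 1%N) k - delta_t (u 0%N) k) / (2 * dt)
                  * (delta_t (u 0%N) k / (2 * dt)))
      - gamma * (\sum_(1 <= n < N.+1) (delta_t (u n) k / (2 * dt)) ^+ 2)
      + c ^+ 2 * ((delta_bar (u 0%N) k - delta_bar (u 1%N) k) / 2)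
        * (delta_t (u 0%N) k / (2 * dt)).
Proof.
move=> k kM; have /andP[k0 k_le_M] := kM; have dt0 : dt != 0 by rewrite gt_eqF.
have sumH : \sum_(1 <= n < N.+1) (H dt c J m2 u n k - H dt c J m2 u n k.-1)
  = energy_flux dt c beta u k N.+1 - energy_flux dt c beta u k 1
    - dt * (beta * \sum_(1 <= n < N.+1)
                     ((delta_t (u n) k - delta_t (u n.-1) k) / (2 * dt)) ^+ 2
            + gamma * \sum_(1 <= n < N.+1) (delta_t (u n) k / (2 * dt)) ^+ 2).
  rewrite -(telescope_sumr (energy_flux dt c beta u k)) // !mulr_sumr -big_split.
  rewrite mulr_sumr -sumrB; apply: eq_big_nat => n n_in /=.
  have /andP[n0 _] := n_in.
  exact/local_energy_balance/scheme.
(* Each term of the flux has a jump across the last link as a factor. These jumps involve only times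
   [k.+1] and [k.-1], both within the range of the Neumann condition. *)
have right_flux : energy_flux dt c beta u k N.+1 = 0.
  have next : u N.+1 k.+1 = u N k.+1 by apply/subr0_eq/right_bc.
  have prev : u N.+1 k.-1 = u N k.-1.
    by apply/subr0_eq/right_bc/(leq_trans (leq_pred k))/leqW.
  by rewrite /energy_flux /delta_t /delta_bar /= next prev !subrr !(mulr0, mul0r) !addr0.
move: sumH; rewrite right_flux sumrB => /eqP; rewrite subr_eq => /eqP sumH.
(* The increment of the boundary term in [E] cancels the [c ^+ 2 / 8] part of the flux at node 1;
   the other two parts, divided by [dt], are the boundary work. *)
rewrite /E sumH; case: k k0 {kM k_le_M sumH right_flux} => // k _.
rewrite /energy_flux /delta_t /delta_bar /=; set S1 := \sum_(_ <= _ < _) _.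
set S2 := \sum_(_ <= _ < _) _; set S3 := \sum_(_ <= _ < _) _.
by field.
Qed.
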